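(* Put $$V_6=(x_6x_5x_3x_2x_1x_4x_3x_2x_5x_3x_4)(x_6x_5x_3x_2x_1),$$ $$V_7=x_7V_6(x_7x_6x_5x_3x_2x_4x_3x_5x_6)x_7,\qquad V_8=x_8V_7x_8V_7x_8.$$ The Garside elements of the Artin monoids $\mathcal{M}(E_6)$, $\mathcal{M}(E_7)$, $\mathcal{M}(E_8)$ are $$\Delta(E_6)=\Delta(D_5)V_6=\Delta(A_4)\Delta(D_5,A_4)V_6,$$ $$\Delta(E_7)=\Delta(E_6)V_7=\Delta(A_4)\Delta(D_5,A_4)V_6V_7,$$ $$\Delta(E_8)=\Delta(E_7)V_8=\Delta(A_4)\Delta(D_5,A_4)V_6V_7V_8.$$
   Context: For $n=6,7,8$ the Coxeter graph $E_n$ has vertices $x_1,\dots,x_n$ and (unlabelled) edges $x_1-x_2$, $x_2-x_3$, $x_3-x_4$, $x_3-x_5$, and $x_i-x_{i+1}$ for $5\le i\le n-1$. Thus $E_6\subset E_7\subset E_8$; $D_5$ denotes the full subgraph on $x_1,\dots,x_5$, and $A_4$ the full subgraph on $x_1,x_2,x_3,x_4$ (a chain). For such a graph $\Gamma$, $\mathcal{M}(\Gamma)$ is the monoid generated by its vertices with relations $x_ix_jx_i=x_jx_ix_j$ if $x_i,x_j$ are joined by an edge and $x_ix_j=x_jx_i$ otherwise; the monoid of a full subgraph is regarded as the submonoid generated by its vertices. The notation $\alpha\mid_L\beta$ means $\beta=\alpha\rho$ for some element $\rho$. The Garside element $\Delta(\Gamma)$ is the unique element of $\mathcal{M}(\Gamma)$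 such that $s\mid_L\Delta(\Gamma)$ for all generators $s$, and whenever $s\mid_L\omega$ for all generators $s$ then $\Delta(\Gamma)\mid_L\omega$. The relative Garside element $\Delta(D_5,A_4)$ is the unique element with $\Delta(D_5)=\Delta(A_4)\Delta(D_5,A_4)$. Explicitly, the paper has $\Delta(A_4)=x_1(x_2x_1)(x_3x_2x_1)(x_4x_3x_2x_1)$ and $\Delta(D_5,A_4)=(x_5x_3x_2x_1)(x_4x_3x_2)(x_5x_3)x_4$. *)

(* Defs.v *)
From HB Require Import structures.
From mathcomp Require Import all_boot.
From mathcomp Require Import boolp classical_sets.

Set Implicit Arguments.
Unset Strict Implicit.
Unset Printing Implicit Defensive.

Local Open Scope quotient_scope.
Local Open Scope group_scope.

Section ArtinMonoid.
Variables (V : choiceType) (e : rel V).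

(* The congruence on words generated by the defining relations of the Artin
   monoid of the graph with adjacency relation [e] and unlabelled edges. *)
Inductive artin_cong : seq V -> seq V -> Prop :=
| ac_refl u : artin_cong u u
| ac_sym u v : artin_cong u v -> artin_cong v u
| ac_trans u v w : artin_cong u v -> artin_cong v w -> artin_cong u w
| ac_braid u v s t :
    e s t -> artin_cong (u ++ [:: s; t; s] ++ v) (u ++ [:: t; s; t] ++ v)
| ac_comm u v s t :
    ~~ e s t -> artin_cong (u ++ [:: s; t] ++ v) (u ++ [:: t; s] ++ v).

Definition artin_rel : rel (seq V) := fun u v => `[< artin_cong u v >].

Lemma artin_rel_equiv : equiv_class_of artin_rel.
Proof.
split=> [u | u v | v u w].
- by apply/asboolP; apply: ac_refl.
- by apply/asboolP/asboolP; apply: ac_sym.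
- move=> /asboolP uv /asboolP vw; apply/asboolP; exact: ac_trans uv vw.
Qed.

Canonical artin_equiv := EquivRelPack artin_rel_equiv.

Definition artin := {eq_quot artin_rel}.

HB.instance Definition _ := Choice.on artin.
HB.instance Definition _ := EqQuotient.on artin.

Lemma artin_eqP (u v : seq V) : (\pi_artin u = \pi_artin v) <-> artin_cong u v.
Proof. by split=> [/eqmodP/asboolP | uv]; last by apply/eqmodP/asboolP. Qed.

Lemma artin_cong_reprK (u : seq V) : artin_cong (repr (\pi_artin u)) u.
Proof. by apply/artin_eqP; rewrite reprK. Qed.

Lemma artin_cong_catl w u v : artin_cong u v -> artin_cong (w ++ u) (w ++ v).
Proof.
elim=> {u v} [u | u v _ | u v x _ + _ | u v s t est | u v s t est].
- exact: ac_refl.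
- exact: ac_sym.
- exact: ac_trans.
- rewrite !(catA w); exact: ac_braid.
- rewrite !(catA w); exact: ac_comm.
Qed.

Lemma artin_cong_catr w u v : artin_cong u v -> artin_cong (u ++ w) (v ++ w).
Proof.
elim=> {u v} [u | u v _ | u v x _ + _ | u v s t est | u v s t est].
- exact: ac_refl.
- exact: ac_sym.
- exact: ac_trans.
- rewrite -!catA; exact: ac_braid.
- rewrite -!catA; exact: ac_comm.
Qed.

Lemma artin_cong_cat u u' v v' :
  artin_cong u u' -> artin_cong v v' -> artin_cong (u ++ v) (u' ++ v').
Proof.
by move=> /(artin_cong_catr v) uu' /(artin_cong_catl u'); apply: ac_trans.
Qed.

Definition artin_one : artin := \pi_artin [::].
Definition artin_mul (a b : artin) : artin := \pi_artin (repr a ++ repr b).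

Lemma artin_mul_pi u v :
  artin_mul (\pi_artin u) (\pi_artin v) = \pi_artin (u ++ v).
Proof. by apply/artin_eqP/artin_cong_cat; apply: artin_cong_reprK. Qed.

Lemma artin_mulA : associative artin_mul.
Proof.
elim/quotW=> u; elim/quotW=> v; elim/quotW=> w.
by rewrite (artin_mul_pi v w) (artin_mul_pi u v) !artin_mul_pi catA.
Qed.

Lemma artin_mul1 : left_id artin_one artin_mul.
Proof. by elim/quotW=> u; rewrite artin_mul_pi. Qed.

Lemma artin_mulr1 : right_id artin_one artin_mul.
Proof. by elim/quotW=> u; rewrite artin_mul_pi cats0. Qed.

HB.instance Definition _ :=
  isMonoid.Build artin artin_mulA artin_mul1 artin_mulr1.

Definition gen (s : V) : artin := \pi_artin [:: s].

Definition dvdL (a b : artin) : Prop := exists r : artin, b = a * r.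

Definition is_garside (d : artin) : Prop :=
  (forall s, dvdL (gen s) d) /\
  (forall w, (forall s, dvdL (gen s) w) -> dvdL d w).

(* [unique P x] says that x satisfies P and is the only such element; the value
   1 is a placeholder for graphs without a Garside element. *)
Definition Delta : artin := xget 1 (unique is_garside).

End ArtinMonoid.

Arguments gen {V} e s.

(* Adjacency of the vertices x_i and x_j with i < j, with labels from 1. *)
Definition Eedge (i j : nat) : bool :=
  ((i, j) \in [:: (1, 2); (2, 3); (3, 4); (3, 5)]%N) || ((5 <= i) && (j == i.+1)).

(* The full subgraph on x_1, ..., x_n of the infinite graph with the adjacency
   [Eedge]; the vertex x_i is the ordinal i - 1. *)
Definition E (n : nat) : rel 'I_n :=
  fun i j => Eedge i.+1 j.+1 || Eedge j.+1 i.+1.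
Arguments E n : clear implicits.

Definition A4 : rel 'I_4 := E 4.
Definition D5 : rel 'I_5 := E 5.

(* x_i as a generator of M(E_(n+1)), meaningful for 1 <= i <= n + 1. *)
Definition x {n : nat} (i : nat) : artin (E n.+1) := gen (E n.+1) (inord i.-1).

Definition word {n : nat} (s : seq nat) : artin (E n.+1) := \prod_(i <- s) x i.

Section Inclusion.
Variables (m n : nat) (le_mn : m <= n).

Definition incl (a : artin (E m)) : artin (E n) :=
  \pi_(artin (E n)) (map (widen_ord le_mn) (repr a)).

Lemma incl_pi u :
  incl (\pi_(artin (E m)) u) = \pi_(artin (E n)) (map (widen_ord le_mn) u).
Proof.
have cong_map v w : artin_cong (E m) v w ->
  artin_cong (E n) (map (widen_ord le_mn) v) (map (widen_ord le_mn) w).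
  elim=> {v w} [v | v w _ | v w y _ + _ | v w s t est | v w s t est].
  - exact: ac_refl.
  - exact: ac_sym.
  - exact: ac_trans.
  - rewrite !map_cat; exact: ac_braid.
  - rewrite !map_cat; exact: ac_comm.
exact/artin_eqP/cong_map/artin_cong_reprK.
Qed.

Lemma incl_monoid_morphism : monoid_morphism incl.
Proof.
split=> [|]; first exact: incl_pi.
elim/quotW=> u; elim/quotW=> v.
by rewrite [_ * _]artin_mul_pi !incl_pi [RHS]artin_mul_pi map_cat.
Qed.

HB.instance Definition _ := isUMagmaMorphism.Build
  (artin (E m)) (artin (E n)) incl incl_monoid_morphism.

Lemma incl_gen i : incl (gen (E m) i) = gen (E n) (widen_ord le_mn i).
Proof. exact: incl_pi. Qed.

(* The relative Garside element Delta(E_n, E_m); 1 is again a placeholder. *)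
Definition relDelta : artin (E n) :=
  xget 1 (unique (fun r => Delta (E n) = incl (Delta (E m)) * r)).

End Inclusion.

(* The inclusion M(E_m) -> M(E_n) for numerals m <= n. *)
Notation "\iota_( m , n )" := (@incl m n isT)
  (at level 0, m at level 10, n at level 10, format "\iota_( m ,  n )").

Definition DeltaD5A4 : artin D5 := @relDelta 4 5 isT.

Definition V6 : artin (E 6) :=
  word [:: 6; 5; 3; 2; 1; 4; 3; 2; 5; 3; 4]%N * word [:: 6; 5; 3; 2; 1]%N.

Definition V7 : artin (E 7) :=
  x 7 * \iota_(6, 7) V6 * word [:: 7; 6; 5; 3; 2; 4; 3; 5; 6]%N * x 7.

Definition V8 : artin (E 8) :=
  x 8 * \iota_(7, 8) V7 * x 8 * \iota_(7, 8) V7 * x 8.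

(* Main.v *)
Require Import Defs.
From mathcomp Require Import all_boot zify.
From mathcomp Require Import classical_sets.

Set Implicit Arguments.
Unset Strict Implicit.
Unset Printing Implicit Defensive.

Local Open Scope quotient_scope.
Local Open Scope group_scope.

(** A Garside element is a least common right multiple of the generators, and
divisibility is antisymmetric because the relations preserve the length of
words. So the Garside element is unique, and it is enough to exhibit one word
for each graph and to show that it represents such a least common multiple.
The words are the ones of the statement, read as words in the labels 1, ..., 8;
each of them extends the previous one, so the factorizations then reduce to
associativity of concatenation and the functoriality of the inclusions. Only
the relative element of A_4 in D_5, defined by a uniqueness property, requires
left cancellation ([artin_mulI]) as well.

Least common multiples rest on Garside's reduction lemma ([gen_mul_eq]): if
s a = t b for generators s and t, then this element is a multiple of the
obvious common multiple of s and t, which is s, st or sts. The lemma is proved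
by induction on the length of a and, for a given length, on the derivation
of the equality of words. A single relation satisfies it; the step that
matters is transitivity ([via_lcm_trans]), a case distinction on the subgraph
spanned by three generators. The graphs E_n are trees, so three distinct
generators span A_3, A_2 + A_1 or 3 A_1, and each case is an explicit
computation in the monoid of that subgraph.

From the lemma for two generators, the least common multiple of two words is
computed by filling a grid with elementary squares, the algorithm known as word
reversing ([complements]); whenever the computation ends, its result is
correct ([complementsP]). Folding it over the generators gives a least common
multiple of all of them, and running it on two words that it finds to have
trivial complements proves that they are equal in the monoid. Both are combined
in the boolean test [is_lcm_word]. An injective relabelling of the generators
does not change the outcome of the test, so that it can be evaluated on the
natural number labels. *)

(** * Length and uniqueness of Garside elements *)

Section Artin.
Variables (V : choiceType) (e : rel V).
Local Notation M := (artin e).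
Local Notation "[ 'w' u ]" := (\pi_(artin e) u) (format "[ 'w'  u ]").

Lemma pi_cat (u v : seq V) : [w u ++ v] = [w u] * [w v].
Proof. by rewrite -artin_mul_pi. Qed.

Lemma pi_cons s (u : seq V) : [w s :: u] = gen e s * [w u].
Proof. exact: pi_cat [:: s] u. Qed.

Lemma artin_cong_size u v : artin_cong e u v -> size u = size v.
Proof.
elim=> {u v} // [u v w _ -> _ -> | u v s t _ | u v s t _] //.
  by rewrite !size_cat.
by rewrite !size_cat.
Qed.

(** The length of any word for [a], by [len_pi]. *)
Definition len (a : M) : nat := size (repr a).

Lemma len_pi u : len [w u] = size u.
Proof. exact/artin_cong_size/artin_cong_reprK. Qed.

Lemma lenM a b : len (a * b) = len a + len b.
Proof.
elim/quotW: a => u; elim/quotW: b => v.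
by rewrite -pi_cat !len_pi size_cat.
Qed.

Lemma len_gen s a : len (gen e s * a) = (len a).+1.
Proof. by rewrite lenM len_pi. Qed.

Lemma len_eq0 a : len a = 0 -> a = 1.
Proof. by elim/quotW: a => u; rewrite len_pi => /size0nil->. Qed.

(** Two elements that divide each other have the same length, so the quotient
has length 0. *)
Lemma dvdL_antisym (a b : M) : dvdL a b -> dvdL b a -> a = b.
Proof.
move=> [r ->] [q E]; suff -> : r = 1 by rewrite mulg1.
by apply/len_eq0/eqP; move: (congr1 len E); rewrite !lenM => /eqP;
   rewrite -addnA -{1}[len a]addn0 eqn_add2l eq_sym addn_eq0 => /andP[].
Qed.

Lemma garside_Delta (d : M) : is_garside d -> Delta e = d.
Proof.
move=> gd; have ud : unique (@is_garside _ e) d.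
  split=> // d' gd'; apply: dvdL_antisym.
    exact/gd.2/gd'.1.
  exact/gd'.2/gd.1.
rewrite /Delta; case: xgetP => [y _ [gy uy] | /(_ d)//]; exact: uy.
Qed.

(** * The reduction lemma *)

Hypothesis e_sym : symmetric e.
Hypothesis e_tri : forall r s t, e r s -> e r t -> ~~ e s t.

Local Notation g := (gen e).

Lemma gen_comm s t z : ~~ e s t -> g s * (g t * z) = g t * (g s * z).
Proof.
move=> st; have : [w [:: s; t]] = [w [:: t; s]].
  exact/artin_eqP/(ac_comm [::] [::]).
by rewrite !pi_cons !mulg1 !mulgA => ->.
Qed.

Lemma gen_braid s t z : e s t ->
  g s * (g t * (g s * z)) = g t * (g s * (g t * z)).
Proof.
move=> st; have : [w [:: s; t; s]] = [w [:: t; s; t]].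
  exact/artin_eqP/(ac_braid [::] [::]).
by rewrite !pi_cons !mulg1 !mulgA => ->.
Qed.

(** The word [compl s t] completes [s] to the least common multiple of [s] and
[t], so [s :: compl s t] and [t :: compl t s] are the two sides of a
defining relation. *)
Definition compl s t : seq V :=
  if s == t then [::] else if e s t then [:: t; s] else [:: t].

(** The equality [g s * a = g t * b] is a multiple of the defining relation of
[s] and [t]. *)
Definition via_lcm s t a b :=
  exists z, a = [w compl s t] * z /\ b = [w compl t s] * z.

Lemma via_lcmC s t a b : via_lcm s t a b -> via_lcm t s b a.
Proof. by move=> [z [? ?]]; exists z. Qed.

Lemma via_lcm_id s a b : via_lcm s s a b <-> a = b.
Proof.
rewrite /via_lcm /compl eqxx; split=> [[z [-> ->]]|->] //.
by exists b; rewrite !mul1g.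
Qed.

Lemma via_lcm_comm s t a b : s != t -> ~~ e s t ->
  via_lcm s t a b <-> exists z, a = g t * z /\ b = g s * z.
Proof.
move=> nst st; rewrite /via_lcm /compl [t == s]eq_sym (negPf nst).
by rewrite [e t s]e_sym (negPf st).
Qed.

Lemma via_lcm_braid s t a b : s != t -> e s t ->
  via_lcm s t a b <-> exists z, a = g t * (g s * z) /\ b = g s * (g t * z).
Proof.
move=> nst st; rewrite /via_lcm /compl [t == s]eq_sym (negPf nst).
rewrite [e t s]e_sym st.
by split=> [] [z [-> ->]]; exists z; rewrite !pi_cons !mulg1 -!mulgA.
Qed.

Lemma via_lcm_mul s t a b : via_lcm s t a b -> g s * a = g t * b.
Proof.
have [->|nst] := eqVneq s t; first by move/via_lcm_id->.
have [st|st] := boolP (e s t).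
  by move=> /(via_lcm_braid _ _ nst st)[z [-> ->]]; apply: gen_braid.
by move=> /(via_lcm_comm _ _ nst st)[z [-> ->]]; apply: gen_comm.
Qed.

(** The transitivity step when the middle generator [r] is joined to [s] but not
to [t]; the three span A_3 or A_2 + A_1. The inductive hypothesis, applied to
ever shorter equalities, writes all factors as multiples of one element, from
which a multiple of the least common multiple of [s] and [t] can be read off. *)
Lemma via_lcm_mixed n r s t a b c :
    (forall s t a b, len a < n -> g s * a = g t * b -> via_lcm s t a b) ->
    len b <= n -> r != s -> r != t -> s != t -> e r s -> ~~ e r t ->
  via_lcm s r a b -> via_lcm r t b c -> via_lcm s t a c.
Proof.
move=> IH lb nrs nrt nst rs rt.
have nsr : s != r by rewrite eq_sym.
have sr : e s r by rewrite e_sym.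
case/(via_lcm_braid _ _ nsr sr) => z [Ea Eb].
case/(via_lcm_comm _ _ nrt rt) => z' [Eb' Ec].
rewrite Eb !len_gen in lb.
have /IH E1 : g s * (g r * z) = g t * z' by rewrite -Eb.
rewrite len_gen in E1; move: (E1 lb) => {}E1.
have [st | st] := boolP (e s t).
  (* A_3 with s in the middle: g s * a is the multiple by q2 of the Garside
     element s t s r s t of A_3. *)
  case/(via_lcm_braid _ _ nst st): E1 => q [/IH E1 Ez'].
  have /E1/(via_lcm_comm _ _ nrt rt)[q' [Ez E2]] : len z < n by lia.
  have lq : len q' = len q by move: (congr1 len E2); rewrite !len_gen => -[].
  move: lb; rewrite Ez len_gen => lb.
  have /IH/(_ E2)/(via_lcm_braid _ _ nsr sr)[q2 [Eq Eq']] : len q < n by lia.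
  apply/(via_lcm_braid _ _ nst st); exists (g r * (g s * (g t * q2))).
  rewrite Ea Ec Ez Ez' Eq Eq'; split.
    rewrite (gen_braid _ st) (gen_comm _ rt) -(gen_comm q2 rt).
    by rewrite (gen_braid _ rs).
  rewrite -(gen_comm _ rt) (gen_braid _ rs) (gen_braid _ st).
  by rewrite (gen_comm _ rt).
case/(via_lcm_comm _ _ nst st): E1 => q [/IH E1 Ez'].
have /E1/(via_lcm_comm _ _ nrt rt)[q' [Ez Eq]] : len z < n by lia.
(* A_2 + A_1: g s * a is the multiple by q' of the product of s r s and t. *)
apply/(via_lcm_comm _ _ nst st); exists (g r * (g s * q')).
rewrite Ea Ec Ez Ez' Eq; split; last exact: gen_braid.
by rewrite (gen_comm _ st) (gen_comm _ rt).
Qed.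

(** Transitivity is where the geometry of the graph enters: through the middle
word starting with [r], two multiples of defining relations compose to a
multiple of the relation of [s] and [t], by the reduction lemma for shorter
words. If [r] is joined to [s] and [t], these two commute since the graph has
no triangle, and the three generators span A_3. *)
Lemma via_lcm_trans n r s t a b c :
    (forall s t a b, len a < n -> g s * a = g t * b -> via_lcm s t a b) ->
    len b <= n -> via_lcm s r a b -> via_lcm r t b c -> via_lcm s t a c.
Proof.
move=> IH lb.
have IHc u x y : len x < n -> g u * x = g u * y -> x = y.
  by move=> lx /(IH _ _ _ _ lx)/via_lcm_id.
have [<- /via_lcm_id-> // | nrs] := eqVneq r s.
have [<- + /via_lcm_id<- // | nrt] := eqVneq r t.
have nsr : s != r by rewrite eq_sym.
have [<- /via_lcmC|nst] := eqVneq s t.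
  have [rs | rs] := boolP (e r s).
    move=> /(via_lcm_braid _ _ nrs rs)[z [Eb ->]].
    move=> /(via_lcm_braid _ _ nrs rs)[z' [Eb' ->]].
    rewrite Eb !len_gen in lb.
    have {}Eb' : g r * z = g r * z' by apply: (IHc s); rewrite ?len_gen -?Eb.
    by apply/via_lcm_id; rewrite (IHc r _ _ _ Eb'); last lia.
  move=> /(via_lcm_comm _ _ nrs rs)[z [Eb ->]].
  move=> /(via_lcm_comm _ _ nrs rs)[z' [Eb' ->]].
  rewrite Eb !len_gen in lb; rewrite Eb in Eb'.
  by apply/via_lcm_id; rewrite (IHc s _ _ _ Eb'); last lia.
have [rs | rs] := boolP (e r s); have [rt | rt] := boolP (e r t).
- (* A_3 with r in the middle: g s * a turns out to be the multiple by y of the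
     Garside element s t r t s r of A_3. *)
  have st : ~~ e s t := e_tri rs rt; have sr : e s r by rewrite e_sym.
  case/(via_lcm_braid _ _ nsr sr) => z [Ea Eb].
  case/(via_lcm_braid _ _ nrt rt) => z' [Eb' Ec].
  rewrite Eb !len_gen in lb.
  have /IH Eq0 : g s * (g r * z) = g t * (g r * z') by rewrite -Eb.
  rewrite len_gen in Eq0.
  have /(via_lcm_comm _ _ nst st)[q [/IH Eq /esym/IH Eq']] := Eq0 lb.
  have /Eq/(via_lcm_braid _ _ nrt rt)[u [Ez Eq1]] : len z < n by lia.
  have lq : len q = len z by rewrite Ez Eq1 !len_gen.
  have /Eq'/(via_lcm_braid _ _ nsr sr)[v [Eq2 Ez']] : len q < n by lia.
  rewrite Ez !len_gen in lb.
  have /IHc Eu : g r * (g t * u) = g r * (g s * v) by rewrite -Eq1.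
  rewrite len_gen in Eu.
  have /Eu/esym/IH : (len u).+1 < n by lia.
  have lv : len v = len u by move: (congr1 len Eq2); rewrite Eq1 !len_gen => -[].
  have lu : len v < n by lia.
  case/(_ lu)/(via_lcm_comm _ _ nst st) => y [Ev Eu'].
  apply/(via_lcm_comm _ _ nst st); exists (g r * (g t * (g s * (g r * y)))).
  rewrite Ea Ec Ez Ez' Eu' Ev; split.
    by rewrite (gen_comm _ st) -(gen_braid _ rs) (gen_braid _ rt).
  rewrite -(gen_comm _ st) -(gen_braid _ rt) (gen_braid _ rs).
  by rewrite (gen_comm _ st).
- exact: (via_lcm_mixed IH).
- move=> /via_lcmC sr /via_lcmC tr; apply/via_lcmC.
  apply: (via_lcm_mixed IH) tr sr => //.
  by rewrite eq_sym.
move=> /(via_lcm_comm _ _ nsr)[|z [-> Eb]]; first by rewrite e_sym.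
move=> /(via_lcm_comm _ _ nrt rt)[z' [Eb' ->]].
rewrite Eb len_gen in lb; rewrite Eb in Eb'; move: (IH _ _ _ _ lb Eb').
have [st | st] := boolP (e s t).
  move=> /(via_lcm_braid _ _ nst st)[q [-> ->]].
  apply/(via_lcm_braid _ _ nst st); exists (g r * q); split.
    by rewrite (gen_comm _ rt) (gen_comm _ rs).
  by rewrite (gen_comm _ rs) (gen_comm _ rt).
move=> /(via_lcm_comm _ _ nst st)[q [-> ->]]; apply/(via_lcm_comm _ _ nst st).
by exists (g r * q); split; exact: gen_comm.
Qed.

(** Stated for words so that it can be proved along the derivation of the
congruence. *)
Lemma cong_via_lcm u v : artin_cong e u v ->
  if (u, v) is (s :: a, t :: b) then via_lcm s t [w a] [w b] else u = v.
Proof.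
have [n] := ubnP (size u); elim: n => // n IHn in u v *.
have IH s t a b : len a < n.-1 -> g s * a = g t * b -> via_lcm s t a b.
  elim/quotW: a => a; elim/quotW: b => b; rewrite len_pi -!pi_cons => la.
  by move=> /artin_eqP/IHn; apply=> /=; lia.
move=> + uv; elim: uv =>
  {u v} [u | u v uv IHuv | u v y uv IHuv vy IHvy | u v s t st | u v s t st].
- by case: u => // s a _; apply/via_lcm_id.
- rewrite -(artin_cong_size uv) => /IHuv.
  by case: u v {uv IHuv} => [|s a] [|t b] // /via_lcmC.
- move=> su; have sv := artin_cong_size uv; have := IHvy.
  rewrite -sv => /(_ su); have := IHuv su.
  case: u v y su sv {uv IHuv vy IHvy} => [|s a] [|r b] [|t c] //= su [sz].
  by move=> ab bc; apply: (via_lcm_trans IH) ab bc; rewrite len_pi -sz; lia.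
- case: u => [|r u] _ /=.
    have [<-|nst] := eqVneq s t; first exact/via_lcm_id.
    apply/(via_lcm_braid _ _ nst st); exists [w v].
    by rewrite !pi_cons.
  by apply/via_lcm_id/artin_eqP/ac_braid.
- case: u => [|r u] _ /=.
    have [<-|nst] := eqVneq s t; first exact/via_lcm_id.
    by apply/(via_lcm_comm _ _ nst st); exists [w v]; rewrite !pi_cons.
  by apply/via_lcm_id/artin_eqP/ac_comm.
Qed.

(** Garside's reduction lemma. *)
Lemma gen_mul_eq s t a b : g s * a = g t * b -> via_lcm s t a b.
Proof.
elim/quotW: a => a; elim/quotW: b => b; rewrite -!pi_cons.
by move=> /artin_eqP/cong_via_lcm.
Qed.

Lemma artin_mulI (a b c : M) : a * b = a * c -> b = c.
Proof.
elim/quotW: a b c => a b c; elim: a => [|s a IH]; first by rewrite !mul1g.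
by rewrite pi_cons -!mulgA => /gen_mul_eq/via_lcm_id.
Qed.

End Artin.

(** * Least common multiples by word reversing *)

(** For words [u] and [v], the pair [(p, q)] such that [u ++ p] and [v ++ q]
represent their least common multiple. For [s :: u] and [t :: v] the elementary
square on [s] and [t] is completed by the grids that its other two sides span
with [u] and with [v], and by a last grid in the opposite corner. Since common
multiples need not exist in general, this recursion may run forever; [k]
bounds its depth. *)
Fixpoint complements (V : choiceType) (e : rel V) k (u v : seq V) :=
  if k is k'.+1 then
    match u, v with
    | [::], _ => Some (v, [::])
    | _, [::] => Some ([::], u)
    | s :: u', t :: v' =>
        if complements e k' u' (compl e s t) is Some (p1, q1) then
        if complements e k' v' (compl e t s) is Some (p2, q2) then
        if complements e k' q1 q2 is Some (p3, q3) then
          Some (p1 ++ p3, p2 ++ q3)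
        else None else None else None
    end
  else None.

(** A word for the least common multiple of [u] and the generators [gs], an
extension of [u]. *)
Fixpoint lcm_word (V : choiceType) (e : rel V) k (u gs : seq V) :=
  if gs is s :: gs' then
    if complements e k u [:: s] is Some (p, _) then lcm_word e k (u ++ p) gs'
    else None
  else Some u.

(** Words that represent the same element are recognized by their trivial
complements. *)
Definition is_lcm_word (V : choiceType) (e : rel V) k (gs w : seq V) :=
  if lcm_word e k [::] gs is Some u then
    complements e k u w == Some ([::], [::])
  else false.

Section Soundness.
Variables (V : choiceType) (e : rel V).
Hypothesis e_sym : symmetric e.
Hypothesis e_tri : forall r s t, e r s -> e r t -> ~~ e s t.
Local Notation "[ 'w' u ]" := (\pi_(artin e) u) (format "[ 'w'  u ]").

(** The reduction lemma is the universal property of an elementary square; it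
passes to the whole grid by composing squares. *)
Lemma complementsP k u v p q : complements e k u v = Some (p, q) ->
  [w u] * [w p] = [w v] * [w q] /\
  (forall a b, [w u] * a = [w v] * b ->
     exists z, a = [w p] * z /\ b = [w q] * z).
Proof.
elim: k u v p q => // k IH [|s u] [|t v] p q /=.
- case=> <- <-; split=> // a b; rewrite !mul1g => ->.
  by exists b; rewrite !mul1g.
- case=> <- <-; split=> [|a b]; rewrite ?mulg1 ?mul1g // => ->.
  by exists b; rewrite mul1g.
- case=> <- <-; split=> [|a b]; rewrite ?mulg1 ?mul1g // => <-.
  by exists a; rewrite mul1g.
case E1: (complements e k u _) => [[p1 q1]|] //.
case E2: (complements e k v _) => [[p2 q2]|] //.
case E3: (complements e k q1 _) => [[p3 q3]|] // [<- <-].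
have [C1 D1] := IH _ _ _ _ E1; have [C2 D2] := IH _ _ _ _ E2.
have [C3 D3] := IH _ _ _ _ E3; rewrite !pi_cons !pi_cat; split.
  rewrite -!mulgA [[w u] * _]mulgA C1 [[w v] * _]mulgA C2 -[in LHS]mulgA C3.
  by apply: (via_lcm_mul e_sym); exists ([w q2] * [w q3]); rewrite !mulgA.
move=> a b; rewrite -!mulgA => /(gen_mul_eq e_sym e_tri).
move=> [z [/D1[z1 [-> Ez]] /D2[z2 [->]]]].
by rewrite Ez => /D3[z3 [-> ->]]; exists z3; rewrite !mulgA.
Qed.

Lemma lcm_wordP k u gs w : lcm_word e k u gs = Some w ->
  [/\ dvdL [w u] [w w], forall s, s \in gs -> dvdL (gen e s) [w w] &
     forall a, dvdL [w u] a -> (forall s, s \in gs -> dvdL (gen e s) a) ->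
       dvdL [w w] a].
Proof.
elim: gs u => [|s gs IH] u /=.
  by case=> <-; split=> //; exists 1; rewrite mulg1.
case E1: complements => [[p q]|] // /IH[[r Er] gs_w w_min].
have [C D] := complementsP E1; rewrite pi_cat in Er w_min; split.
- by exists ([w p] * r); rewrite mulgA.
- move=> t; rewrite inE => /predU1P[->|]; last exact: gs_w.
  by exists ([w q] * r); rewrite Er C mulgA.
move=> a [b Eb] gs_a; apply: w_min; last first.
  by move=> t tgs; apply: gs_a; rewrite inE tgs orbT.
have [c] := gs_a s (mem_head _ _); rewrite Eb => /D[z [-> _]].
by exists z; rewrite mulgA.
Qed.

Lemma is_lcm_word_garside k gs w :
  (forall s, s \in gs) -> is_lcm_word e k gs w -> is_garside [w w].
Proof.
move=> gs_all; rewrite /is_lcm_word.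
case E1: lcm_word => [u|] // /eqP/complementsP[+ _].
rewrite !mulg1 => <-; have [_ div min] := lcm_wordP E1; split=> [s|a sa].
  exact/div/gs_all.
by apply: min => [|s _]; [exists a; rewrite mul1g | exact: sa].
Qed.

End Soundness.

(** The test only compares generators and looks up edges, so it may be evaluated
on the images of the generators in another graph that induces the same edges on
them. *)
Section Relabelling.
Variables (V V' : choiceType) (e : rel V) (e' : rel V') (f : V -> V').
Hypothesis f_inj : injective f.
Hypothesis f_e : forall s t, e' (f s) (f t) = e s t.

Lemma compl_map s t : compl e' (f s) (f t) = map f (compl e s t).
Proof. by rewrite /compl (inj_eq f_inj) f_e; do 2?case: ifP. Qed.

Definition map_pair (pq : seq V * seq V) := (map f pq.1, map f pq.2).

Lemma complements_map k u v :
  complements e' k (map f u) (map f v) = omap map_pair (complements e k u v).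
Proof.
elim: k u v => //= k IH [|s u] [|t v] //=; rewrite !compl_map !IH.
case: complements => [[p1 q1]|] //=; case: complements => [[p2 q2]|] //=.
rewrite IH; case: complements => [[p3 q3]|] //=.
by rewrite /map_pair /= !map_cat.
Qed.

Lemma lcm_word_map k u gs :
  lcm_word e' k (map f u) (map f gs) = omap (map f) (lcm_word e k u gs).
Proof.
elim: gs u => //= s gs IH u; rewrite (complements_map k u [:: s]).
by case: complements => [[p q]|] //=; rewrite -map_cat IH.
Qed.

Lemma is_lcm_word_map k gs w :
  is_lcm_word e' k (map f gs) (map f w) = is_lcm_word e k gs w.
Proof.
rewrite /is_lcm_word (lcm_word_map k [::]); case: lcm_word => [u|] //=.
by rewrite complements_map; case: complements => [[[|? ?] [|? ?]]|].
Qed.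

End Relabelling.

(** * Words in the labels of the graphs E_n *)

Definition label_edge : rel nat := fun i j => Eedge i j || Eedge j i.

Lemma E_sym n : symmetric (E n).
Proof. by move=> i j; rewrite /E orbC. Qed.

(** Every vertex has at most one neighbour with a smaller label, so the largest
vertex of a triangle would have too many. *)
Lemma E_tri n r s t : E n r s -> E n r t -> ~~ E n s t.
Proof. by rewrite /E /Eedge !inE !xpair_eqE; lia. Qed.

Section Words.
Variable n : nat.

Definition letters (s : seq nat) : seq 'I_n.+1 := [seq inord i.-1 | i <- s].

Lemma wordE (s : seq nat) : word s = \pi_(artin (E n.+1)) (letters s).
Proof.
elim: s => [|i s IH]; rewrite /word ?big_nil // big_cons -/(word s) IH.
by rewrite -pi_cons.
Qed.

Lemma word_cat s t : word (s ++ t) = word s * word t :> artin (E n.+1).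
Proof. exact: big_cat. Qed.

Definition labels m (s : seq nat) := all (fun i => 0 < i <= m) s.

(** The test is evaluated on labels because [inord] and the enumeration of
ordinals are built on opaque proofs and do not compute. *)
Lemma word_garside k (s : seq nat) :
  labels n.+1 s -> is_lcm_word label_edge k (iota 1 n.+1) s ->
  is_garside (word s : artin (E n.+1)).
Proof.
move=> /allP s_lab; rewrite wordE.
pose label (i : 'I_n.+1) := i.+1.
have label_inj : injective label by move=> i j [/val_inj].
have -> : iota 1 n.+1 = map label (enum 'I_n.+1).
  by rewrite (map_comp S val) val_enum_ord (iotaDl 1 0).
have {1}-> : s = map label (letters s).
  rewrite -map_comp -[LHS]map_id; apply/eq_in_map => i /s_lab /andP[i0 il] /=.
  by rewrite /label inordK prednK.
rewrite (is_lcm_word_map (e := E n.+1) label_inj) //.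
apply: is_lcm_word_garside => [||s']; last by rewrite mem_enum.
  exact: E_sym.
exact: E_tri.
Qed.

End Words.

Lemma incl_word m n (le_mn : m.+1 <= n.+1) s : labels m.+1 s ->
  incl le_mn (word s) = word s.
Proof.
move=> /allP s_lab; rewrite !wordE incl_pi -map_comp; congr (\pi_(artin _) _).
apply/eq_in_map => i /s_lab /andP[i0 il]; apply/val_inj => /=.
by rewrite !inordK ?prednK // (leq_trans il).
Qed.

(** * The Garside elements *)

Definition a4 := [:: 1; 2; 1; 3; 2; 1; 4; 3; 2; 1]%N.
Definition d5_a4 := [:: 5; 3; 2; 1; 4; 3; 2; 5; 3; 4]%N.
Definition v6 := [:: 6; 5; 3; 2; 1; 4; 3; 2; 5; 3; 4; 6; 5; 3; 2; 1]%N.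
Definition v7 := 7 :: v6 ++ [:: 7; 6; 5; 3; 2; 4; 3; 5; 6; 7]%N.
Definition v8 := 8 :: v7 ++ 8 :: v7 ++ [:: 8]%N.
Definition d5 := a4 ++ d5_a4.
Definition e6 := d5 ++ v6.
Definition e7 := e6 ++ v7.
Definition e8 := e7 ++ v8.

(* A recursion depth of 200 is ample: the largest computation, the one for E_8,
   needs a little more than 100. *)

Lemma garside_a4 : is_garside (word a4 : artin A4).
Proof. by apply: (@word_garside 3 200); vm_compute. Qed.

Lemma garside_d5 : is_garside (word d5 : artin D5).
Proof. by apply: (@word_garside 4 200); vm_compute. Qed.

Lemma garside_e6 : is_garside (word e6 : artin (E 6)).
Proof. by apply: (@word_garside 5 200); vm_compute. Qed.

Lemma garside_e7 : is_garside (word e7 : artin (E 7)).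
Proof. by apply: (@word_garside 6 200); vm_compute. Qed.

Lemma garside_e8 : is_garside (word e8 : artin (E 8)).
Proof. by apply: (@word_garside 7 200); vm_compute. Qed.

Lemma V6_word : V6 = word v6.
Proof. by rewrite /V6 -word_cat. Qed.

Lemma x_word n i : x i = word [:: i] :> artin (E n.+1).
Proof. by rewrite /word big_seq1. Qed.

Lemma V7_word : V7 = word v7.
Proof. by rewrite /V7 V6_word incl_word // !x_word -!word_cat. Qed.

Lemma V8_word : V8 = word v8.
Proof. by rewrite /V8 V7_word incl_word // !x_word -!word_cat. Qed.

(** The uniqueness in the definition of the relative Garside element is left
cancellation. *)
Lemma DeltaD5A4_word : DeltaD5A4 = word d5_a4.
Proof.
have D5E : Delta D5 = incl (isT : 4 <= 5) (Delta A4) * word d5_a4.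
  rewrite (garside_Delta garside_a4) (garside_Delta garside_d5).
  by rewrite incl_word // -word_cat.
have uniq_r :
    unique (fun r => Delta D5 = incl (isT : 4 <= 5) (Delta A4) * r)
      (word d5_a4).
  split=> // r; rewrite /= D5E; apply: artin_mulI.
    exact: E_sym.
  exact: E_tri.
rewrite /DeltaD5A4 /relDelta.
by case: xgetP => [r _ [Er ur] | /(_ _ uniq_r)//]; apply: ur.
Qed.

Theorem corollary7 :
  [/\ is_garside (Delta A4), is_garside (Delta D5), is_garside (Delta (E 6)),
      is_garside (Delta (E 7)) & is_garside (Delta (E 8))] /\
  [/\ Delta (E 6) = \iota_(5, 6) (Delta D5) * V6,
      \iota_(5, 6) (Delta D5) * V6
        = \iota_(4, 6) (Delta A4) * \iota_(5, 6) DeltaD5A4 * V6 &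
  [/\ Delta (E 7) = \iota_(6, 7) (Delta (E 6)) * V7,
      \iota_(6, 7) (Delta (E 6)) * V7
        = \iota_(4, 7) (Delta A4) * \iota_(5, 7) DeltaD5A4
          * \iota_(6, 7) V6 * V7 &
  [/\ Delta (E 8) = \iota_(7, 8) (Delta (E 7)) * V8 &
      \iota_(7, 8) (Delta (E 7)) * V8
        = \iota_(4, 8) (Delta A4) * \iota_(5, 8) DeltaD5A4
          * \iota_(6, 8) V6 * \iota_(7, 8) V7 * V8]]].
Proof.
rewrite (garside_Delta garside_a4) (garside_Delta garside_d5).
rewrite (garside_Delta garside_e6) (garside_Delta garside_e7).
rewrite (garside_Delta garside_e8) DeltaD5A4_word V6_word V7_word V8_word.
split; first by split; [exact: garside_a4 | exact: garside_d5
  | exact: garside_e6 | exact: garside_e7 | exact: garside_e8].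
by rewrite !incl_word // -!word_cat.
Qed.
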